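(* Let $q\in\mathbb{C}$ with $0<|q|<1$, $d\in\mathbb{C}$ with $d\neq q^2$, and $j\ge0$ an integer. Then \[ \sum_{n=0}^{j} {j \brack n}_q \left(\frac{d}{q}\right)_{j-n} \left(\frac{-d}{q}\right)^n q^{n(n-1)/2}=\frac{(q)_j}{1-d/q^2} \sum_{t=0}^{j+1} \sum_{n=0}^{t} \frac{(2n-t)(d/q^2)_n(d/q^2)_{t-n}(-1)^{j+1-t}q^{(t-n)+(j-t)(j-t+1)/2}}{(q)_n(q)_{t-n}(q)_{j+1-t}}. \]
   Context: $(A)_n=(A;q)_n=\prod_{i=0}^{n-1}(1-Aq^i)$; ${j \brack n}_q=\frac{(q)_j}{(q)_n(q)_{j-n}}$ is the Gaussian binomial coefficient. *)

(* Defs.v *)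
From HB Require Import structures.
From mathcomp Require Import all_boot all_order all_algebra.
From mathcomp Require Import reals.
From mathcomp Require Export complex.

Set Implicit Arguments.
Unset Strict Implicit.
Unset Printing Implicit Defensive.

Import GRing.Theory.
Local Open Scope ring_scope.

Definition qpoch (F : fieldType) (A q : F) (n : nat) : F :=
  \prod_(i < n) (1 - A * q ^+ i).

(* Used only for n <= j, so the subtraction j - n is never truncated. *)
Definition qbinom (F : fieldType) (q : F) (j n : nat) : F :=
  qpoch q q j / (qpoch q q n * qpoch q q (j - n)).

(* Main.v *)
Require Import Defs.
From HB Require Import structures.
From mathcomp Require Import all_boot all_order all_algebra.
From mathcomp Require Import reals complex ring.

Set Implicit Arguments.
Unset Strict Implicit.
Unset Printing Implicit Defensive.

Import Order.TTheory GRing.Theory Num.Theory.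
Local Open Scope ring_scope.
Local Open Scope complex_scope.

(** Put [a = d / q^2] and consider the power series
    [f(z) = (az)_oo / (z)_oo], [g(z) = (aqz)_oo / (z)_oo] and [e(z) = (z)_oo].
    Since [f(z) = (1 - az) g(z)] and [f(qz) = (1 - z) g(z)], the Wronskian
    [z f'(z) f(qz) - z f(z) (f(qz))'], whose coefficients are the inner sums on
    the right-hand side, equals [(1 - a) z g(z)^2]. The right-hand side is thus
    the coefficient of [z^j] in [g(z)^2 e(z) = g(z) (aqz)_oo], up to the factor
    [(q)_j], and the left-hand side is the Cauchy product of the last two
    series. Polynomial truncations stand for the power series. *)

Section QSeries.

Variables (F : fieldType) (q : F).
Hypothesis q_nonroot : forall n, q ^+ n.+1 != 1.

(** Coefficients of [(az)_oo / (z)_oo], by the q-binomial theorem. *)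
Definition qratio_coef (a : F) (n : nat) : F := qpoch a q n / qpoch q q n.

(* Coefficients of [(xz)_oo], by Euler's expansion. *)
Definition qexp_coef (x : F) (n : nat) : F :=
  (- x) ^+ n * q ^+ 'C(n, 2) / qpoch q q n.

Lemma qpochS (a : F) n : qpoch a q n.+1 = qpoch a q n * (1 - a * q ^+ n).
Proof. by rewrite /qpoch big_ord_recr. Qed.

Lemma qpochSl (a : F) n : qpoch a q n.+1 = (1 - a) * qpoch (a * q) q n.
Proof.
rewrite /qpoch big_ord_recl expr0 mulr1; congr (_ * _).
by apply: eq_bigr => i _; rewrite /bump /= exprS mulrA.
Qed.

Lemma one_sub_exp_neq0 n : 1 - q ^+ n.+1 != 0.
Proof. by rewrite subr_eq0 eq_sym. Qed.

Lemma qpoch_neq0 n : qpoch q q n != 0.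
Proof.
by apply/prodf_neq0 => i _; rewrite -exprS one_sub_exp_neq0.
Qed.

Lemma qratio_coef0 a : qratio_coef a 0 = 1.
Proof. by rewrite /qratio_coef /qpoch !big_ord0 divr1. Qed.

Lemma qexp_coef0 x : qexp_coef x 0 = 1.
Proof. by rewrite /qexp_coef /qpoch big_ord0 !expr0 mulr1 divr1. Qed.

Lemma qratio_coefS a n :
  (1 - q ^+ n.+1) * qratio_coef a n.+1 = (1 - a * q ^+ n) * qratio_coef a n.
Proof.
have h1 := one_sub_exp_neq0 n; have h2 := qpoch_neq0 n.
rewrite /qratio_coef !qpochS -exprS; field; exact/andP.
Qed.

Lemma qexp_coefS x n :
  (1 - q ^+ n.+1) * qexp_coef x n.+1 = - x * q ^+ n * qexp_coef x n.
Proof.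
have h1 := one_sub_exp_neq0 n; have h2 := qpoch_neq0 n.
rewrite /qexp_coef qpochS -exprS binS bin1 exprD [(- x) ^+ _]exprS; field; exact/andP.
Qed.

(** Coefficientwise form of [f(z) = (1 - az) g(z)]; [g] is [f] with [aq] in place of [a]. *)
Lemma qratio_coef_shift a n :
  qratio_coef a n.+1 = qratio_coef (a * q) n.+1 - a * qratio_coef (a * q) n.
Proof.
have h1 := one_sub_exp_neq0 n; have h2 := qpoch_neq0 n.
rewrite /qratio_coef qpochSl !qpochS -exprS.
rewrite exprS in h1 *; field; exact/andP.
Qed.

(** Coefficientwise form of [f(qz) = (1 - z) g(z)]. *)
Lemma qratio_coef_dilate a n :
  q ^+ n.+1 * qratio_coef a n.+1
  = qratio_coef (a * q) n.+1 - qratio_coef (a * q) n.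
Proof.
have h1 := one_sub_exp_neq0 n; have h2 := qpoch_neq0 n.
rewrite /qratio_coef qpochSl !qpochS -exprS.
rewrite exprS in h1 *; field; exact/andP.
Qed.

(** This is [((bz)_oo / (z)_oo) (z)_oo = (bz)_oo]: the convolution obeys the recurrence
    [qexp_coefS]. *)
Lemma qratio_qexp_conv b k :
  \sum_(n < k.+1) qratio_coef b n * qexp_coef 1 (k - n) = qexp_coef b k.
Proof.
elim: k => [|k IHk].
  by rewrite big_ord1 subn0 qratio_coef0 !qexp_coef0 mulr1.
apply: (mulfI (one_sub_exp_neq0 k)); rewrite qexp_coefS -IHk !mulr_sumr.
(* A q-Leibniz splitting of [1 - q ^+ k.+1]: in [u] the recurrence lowers the first index, in [v]
   the second. *)
pose u n := q ^+ (k.+1 - n) * ((1 - q ^+ n) * qratio_coef b n)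
  * qexp_coef 1 (k.+1 - n).
pose v n := qratio_coef b n
  * ((1 - q ^+ (k.+1 - n)) * qexp_coef 1 (k.+1 - n)).
rewrite (eq_bigr (fun n : 'I_k.+2 => u n + v n)); last first.
  move=> n _; rewrite /u /v.
  have -> : q ^+ k.+1 = q ^+ (k.+1 - n) * q ^+ n.
    by rewrite -exprD subnK // -ltnS.
  ring.
rewrite big_split big_ord_recl /= [X in _ + X]big_ord_recr /=.
have -> : u 0%N = 0 by rewrite /u expr0 subrr mul0r mulr0 mul0r.
have -> : v k.+1 = 0 by rewrite /v subnn expr0 subrr mul0r mulr0.
(* With [u] reindexed by one, the factors add up to [q ^+ (k - n) * (1 - b * q ^+ n) - q ^+ (k - n)
   = - b * q ^+ k]. *)
rewrite add0r addr0 -big_split; apply: eq_bigr => n _ /=.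
have le_nk : (n <= k)%N by rewrite -ltnS.
rewrite /u /v /bump add1n subSS qratio_coefS subSn // qexp_coefS.
have -> : q ^+ k = q ^+ (k - n) * q ^+ n by rewrite -exprD subnK.
ring.
Qed.

Section Truncation.

Variables (a : F) (N : nat).

Let G : {poly F} := \poly_(i < N) qratio_coef (a * q) i.
Let A : {poly F} := (1 - a *: 'X) * G.
Let B : {poly F} := (1 - 'X) * G.

Lemma coef_truncation_shift n : (n < N)%N -> A`_n = qratio_coef a n.
Proof.
move=> lt_nN; rewrite /A mulrBl mul1r -scalerAl coefB coefZ coefXM !coef_poly.
rewrite lt_nN; case: n lt_nN => [|n] lt_nN /=.
  by rewrite mulr0 subr0 !qratio_coef0.
by rewrite (ltnW lt_nN) (qratio_coef_shift a).
Qed.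

Lemma coef_truncation_dilate n :
  (n < N)%N -> B`_n = q ^+ n * qratio_coef a n.
Proof.
move=> lt_nN; rewrite /B mulrBl mul1r coefB coefXM !coef_poly.
rewrite lt_nN; case: n lt_nN => [|n] lt_nN /=.
  by rewrite subr0 expr0 mul1r !qratio_coef0.
by rewrite (ltnW lt_nN) qratio_coef_dilate.
Qed.

Lemma truncation_wronskian : A^`() * B - A * B^`() = (1 - a) *: (G * G).
Proof.
rewrite /A /B !derivM !derivB derivZ derivX derivC -!mul_polyC polyCB.
ring.
Qed.

(** Since ['X] times the derivative multiplies the [n]-th coefficient by [n], the Wronskian produces
    the weight [n - (t - n) = 2n - t]. *)
Lemma qratio_wronskian_coef t : (t < N)%N ->
  \sum_(n < t.+1) ((2 * n)%:R - t%:R) * (qratio_coef a n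
     * (q ^+ (t - n) * qratio_coef a (t - n)))
  = ('X * ((1 - a) *: (G * G)))`_t.
Proof.
move=> lt_tN; rewrite -truncation_wronskian mulrBr mulrA [_ * (A * _)]mulrCA.
have coefXD (p : {poly F}) n : ('X * p^`())`_n = p`_n * n%:R.
  by rewrite mulr_natr coefXM coef_deriv; case: n.
rewrite coefB !coefM -sumrB; apply: eq_bigr => n _.
have le_nt : (n <= t)%N by rewrite -ltnS.
rewrite !coefXD !coef_truncation_shift ?coef_truncation_dilate;
  try exact: leq_ltn_trans lt_tN; last exact: leq_ltn_trans (leq_subr _ _) lt_tN.
have -> : t%:R = (t - n)%:R + n%:R :> F by rewrite -natrD subnK.
rewrite natrM; ring.
Qed.

End Truncation.

Lemma qratio_wronskian_qexp a j :
  \sum_(t < j.+2) (\sum_(n < t.+1) ((2 * n)%:R - t%:R) * (qratio_coef a n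
     * (q ^+ (t - n) * qratio_coef a (t - n)))) * qexp_coef 1 (j.+1 - t)
  = (1 - a) * \sum_(n < j.+1) qexp_coef (a * q) n * qratio_coef (a * q) (j - n).
Proof.
(* Only coefficients of index at most [j.+1] are read, so [j.+2] terms suffice. *)
pose G := \poly_(i < j.+2) qratio_coef (a * q) i.
pose E := \poly_(i < j.+2) qexp_coef 1 i.
transitivity (('X * ((1 - a) *: (G * G)) * E)`_j.+1).
  rewrite coefM; apply: eq_bigr => t _; rewrite (qratio_wronskian_coef _ (ltn_ord t)).
  by rewrite [E`__]coef_poly ltnS leq_subr.
(* The factor ['X] lowers the index to [j]. The product is regrouped as [(G * E) * G], where [G * E]
   agrees with [(aqz)_oo] up to that index. *)
rewrite -mulrA coefXM /= -scalerAl coefZ -mulrA [G * _]mulrC coefM.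
congr (_ * _); apply: eq_bigr => n _.
have lt_nj : (n < j.+2)%N by apply: ltnW; rewrite ltnS.
rewrite [G`__]coef_poly ltnS (leq_trans (leq_subr _ _)) //; congr (_ * _).
rewrite coefM -qratio_qexp_conv; apply: eq_bigr => i _.
have lt_ij : (i < j.+2)%N by exact: leq_trans (ltn_ord i) lt_nj.
rewrite !coef_poly lt_ij (leq_ltn_trans _ lt_nj) //; exact: leq_subr.
Qed.

End QSeries.

(* On the right-hand side the natural-number exponent (j - t)(j - t + 1)/2 is
   truncated only at t = j + 1, where both readings give 0. *)
Theorem theorem6p2 (R : realType) (q d : R[i]) (j : nat)
    (hq : 0 < `|q| < 1) (hd : d != q ^+ 2) :
  \sum_(0 <= n < j.+1)
      qbinom q j n * qpoch (d / q) q (j - n) * (- d / q) ^+ n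
        * q ^+ ((n * (n - 1)) %/ 2)
  = qpoch q q j / (1 - d / q ^+ 2) *
    \sum_(0 <= t < j.+2) \sum_(0 <= n < t.+1)
      ((2 * n)%:R - t%:R) * qpoch (d / q ^+ 2) q n
        * qpoch (d / q ^+ 2) q (t - n) * (-1) ^+ (j.+1 - t)
        * q ^+ ((t - n) + ((j - t) * (j - t + 1)) %/ 2)
      / (qpoch q q n * qpoch q q (t - n) * qpoch q q (j.+1 - t)).
Proof.
have /andP[q_gt0 q_lt1] := hq.
have q_neq0 : q != 0 by rewrite -normr_gt0.
have q_nonroot n : q ^+ n.+1 != 1.
  apply/negP => /eqP qn1; have := exprn_ilt1 n.+1 (normr_ge0 q) q_lt1.
  by rewrite -normrX qn1 normr1 ltxx.
set a := d / q ^+ 2.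
have a_neq1 : 1 - a != 0.
  rewrite subr_eq0 eq_sym; apply: contra hd => /eqP a1.
  by rewrite -[d](divfK (expf_neq0 2 q_neq0)) -/a a1 mul1r.
have aqE : d / q = a * q by rewrite /a; field.
rewrite mulNr aqE !big_mkord.
have -> : \sum_(t < j.+2) \sum_(0 <= n < t.+1)
      ((2 * n)%:R - t%:R) * qpoch a q n
        * qpoch a q (t - n) * (-1) ^+ (j.+1 - t)
        * q ^+ ((t - n) + ((j - t) * (j - t + 1)) %/ 2)
      / (qpoch q q n * qpoch q q (t - n) * qpoch q q (j.+1 - t))
  = \sum_(t < j.+2) (\sum_(n < t.+1) ((2 * n)%:R - t%:R) * (qratio_coef q a n
     * (q ^+ (t - n) * qratio_coef q a (t - n)))) * qexp_coef q 1 (j.+1 - t).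
  apply: eq_bigr => t _; rewrite big_mkord mulr_suml; apply: eq_bigr => n _.
  have -> : (((j - t) * (j - t + 1)) %/ 2 = 'C(j.+1 - t, 2))%N.
    have := ltn_ord t; rewrite ltnS leq_eqVlt => /predU1P[->|lt_tj].
      by rewrite subnn (eqP (leqnSn j)).
    by rewrite subSn // bin2 divn2 mulnC addn1.
  rewrite /qratio_coef /qexp_coef exprD.
  by field; rewrite !qpoch_neq0.
(* The factor [1 - a] cancels the denominator, and the two sums then agree term by term. *)
rewrite qratio_wronskian_qexp // mulrA divfK // mulr_sumr.
apply: eq_bigr => n _.
rewrite /qbinom /qexp_coef /qratio_coef bin2 divn2 subn1.
by field; rewrite !qpoch_neq0.
Qed.
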